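(* Let $\Gamma$ be a general network, and let $l_1=\oplus(P_1|S_1)$ and $l_2=\oplus(P_2|S_2)$ be two non-empty elements of $\mathcal{L}(\Gamma)$. For $i=1,2$ let $S_{P_i}$ be the set of all 2-chains $\oplus(t,t')$ with $t,t'\in P_i$. If $|P_1|=|P_2|$, $|S_{P_1}|=|S_{P_2}|$ and there exist two bijections $\theta:P_1\to P_2$ and $\tau:S_{P_1}\to S_{P_2}$ with $\tau(\oplus(t,t'))=\oplus(\theta(t),\theta(t'))\in S_{P_2}$ for every $\oplus(t,t')\in S_{P_1}$, then the $\delta$-classes $l_1\delta$ and $l_2\delta$ are isomorphic semilattices with respect to $\mathring{\cup}$.
   Context: A general network $\Gamma$ has a finite vertex set $\Gamma^0$ and a finite set $T$ of tensors. A tensor $t=T_A^B$ is given by a non-empty set $A\subseteq\Gamma^0$ of covariant indexes and a (possibly empty) set $B\subseteq\Gamma^0$ of contra-variant indexes; its index set is $I(t)=A\cup B$. A 2-chain is an unordered pair $\oplus(t_i,t_j)$ of distinct tensors $t_i,t_j\in T$ with $I(t_i)\cap I(t_j)\neq\emptyset$. A (non-empty) tensor chain is $\oplus(P|S)$, where $P\subseteq T$ is non-empty, $S$ is a set of 2-chains between elements of $P$, and the pair is connected: any two distinct $t_i,t_j\in P$ are joined by a sequence $t_i=t_{k_1},\dots,t_{k_m}=t_j$ in $P$ with $\oplus(t_{k_\ell},t_{k_{\ell+1}})\in S$ for all $1\le \ell<m$. A tensor chain is determined by $(P,S)$; a single tensor $t$ is the chain with $P=\{t\}$, $S=\varnothing$.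 $\mathcal{L}(\Gamma)$ is the set of all non-empty tensor chains together with an extra element $\emptyset$ (the empty relation), whose tensor set is regarded as empty. Reducing: for non-empty chains $l_1=\oplus(P_1|S_1)$, $l_2=\oplus(P_2|S_2)$, put $l_1\mathring{\cup}l_2=\oplus(P_1\cup P_2|S_1\cup S_2)$ if $P_1\cap P_2\neq\varnothing$ and $l_1\mathring{\cup}l_2=\emptyset$ otherwise; also $\emptyset\mathring{\cup}l=l\mathring{\cup}\emptyset=\emptyset$ for all $l$. The relation $\delta$ on $\mathcal{L}(\Gamma)$: two elements are $\delta$-related if and only if they have the same tensor set $P$; $l\delta$ denotes the $\delta$-class of $l$, which is a semilattice (idempotent commutative semigroup) under $\mathring{\cup}$. *)

(* Defs.v *)
From HB Require Import structures.
From mathcomp Require Import all_boot.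

Set Implicit Arguments.
Unset Strict Implicit.
Unset Printing Implicit Defensive.

(* Tensors are labels carrying index sets, so that two distinct tensors may
   have the same covariant and contravariant indexes. *)
Record network := Network {
  vertex : finType;
  tensor : finType;
  cov : tensor -> {set vertex};
  contra : tensor -> {set vertex};
  cov_neq0 : forall t, cov t != set0
}.

Section TensorChains.
Variable G : network.
Implicit Types (t u : tensor G) (P : {set tensor G}) (c : {set tensor G}).
Implicit Types S : {set {set tensor G}}.

Definition indexes t : {set vertex G} := cov t :|: contra t.

(* The 2-chain on t and t' is represented by the unordered pair [set t; t']. *)
Definition two_chain c : bool :=
  [exists t, exists t',
    [&& t != t', indexes t :&: indexes t' != set0 & c == [set t; t']]].

Definition two_chains_on P : {set {set tensor G}} :=
  [set c | two_chain c & c \subset P].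

Definition link P S : rel (tensor G) :=
  [rel t t' | [&& t \in P, t' \in P & [set t; t'] \in S]].

Definition is_chain (l : {set tensor G} * {set {set tensor G}}) : bool :=
  [&& l.1 != set0, l.2 \subset two_chains_on l.1
    & [forall t in l.1, forall t' in l.1, connect (link l.1 l.2) t t']].

Definition chain := {l : {set tensor G} * {set {set tensor G}} | is_chain l}.

Definition chain_tensors (l : chain) : {set tensor G} := (val l).1.
Definition chain_links (l : chain) : {set {set tensor G}} := (val l).2.

Lemma chain_tensors_neq0 (l : chain) : chain_tensors l != set0.
Proof. by case/and3P: (valP l). Qed.

Lemma is_chainU (l1 l2 : chain) :
  chain_tensors l1 :&: chain_tensors l2 != set0 ->
  is_chain (chain_tensors l1 :|: chain_tensors l2,
            chain_links l1 :|: chain_links l2).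
Proof.
rewrite /chain_tensors /chain_links; case: l1 l2 => [[P1 S1] h1] [[P2 S2] h2] /=.
case/and3P: h1 => /= P1n sS1 /forall_inP c1.
case/and3P: h2 => /= P2n sS2 /forall_inP c2 /set0Pn[w /setIP[w1 w2]].
apply/and3P; split => /=.
- by apply/set0Pn; exists w; rewrite inE w1.
- apply/subsetP => c /setUP[/(subsetP sS1)|/(subsetP sS2)];
    rewrite !inE => /andP[-> /= /subset_trans]; apply.
    exact: subsetUl.
  exact: subsetUr.
have sub1 t u : connect (link P1 S1) t u ->
    connect (link (P1 :|: P2) (S1 :|: S2)) t u.
  apply: connect_sub => {}t {}u /= /and3P[tP uP tuS].
  by apply: connect1; rewrite /link /= !inE tP uP tuS.
have sub2 t u : connect (link P2 S2) t u ->
    connect (link (P1 :|: P2) (S1 :|: S2)) t u.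
  apply: connect_sub => {}t {}u /= /and3P[tP uP tuS].
  by apply: connect1; rewrite /link /= !inE tP uP tuS !orbT.
apply/forall_inP => t tP; apply/forall_inP => u uP.
apply: (@connect_trans _ _ w).
- case/setUP: tP => tP; first exact/sub1/(forall_inP (c1 t tP)).
  exact/sub2/(forall_inP (c2 t tP)).
- case/setUP: uP => uP; first exact/sub1/(forall_inP (c1 w w1)).
  exact/sub2/(forall_inP (c2 w w2)).
Qed.

Definition chainU (l1 l2 : chain)
    (meet12 : chain_tensors l1 :&: chain_tensors l2 != set0) : chain :=
  Sub (chain_tensors l1 :|: chain_tensors l2,
       chain_links l1 :|: chain_links l2) (is_chainU meet12).

(* [None] is the empty relation. *)
Definition relations := option chain.

Definition tensors (l : relations) : {set tensor G} :=
  if l is Some k then chain_tensors k else set0.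

Definition reducing (l1 l2 : relations) : relations :=
  match l1, l2 with
  | Some k1, Some k2 =>
      if decP (@idP (chain_tensors k1 :&: chain_tensors k2 != set0))
        is left meet12 then Some (chainU meet12) else None
  | _, _ => None
  end.

Definition delta : rel relations := [rel l1 l2 | tensors l1 == tensors l2].

Definition delta_class (l : relations) := {k : relations | delta l k}.

Definition links (l : relations) : {set {set tensor G}} :=
  if l is Some k then chain_links k else set0.

Lemma relations_inj (l1 l2 : relations) :
  tensors l1 = tensors l2 -> links l1 = links l2 -> l1 = l2.
Proof.
case: l1 l2 => [k1|] [k2|] //=.
- by move=> eP eS; congr Some; apply: val_inj; apply/eqP/andP; split; apply/eqP.
- by move/eqP; rewrite (negPf (chain_tensors_neq0 k1)).
- by move=> /esym/eqP; rewrite (negPf (chain_tensors_neq0 k2)).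
Qed.

Lemma reducing_delta (l1 l2 : relations) : tensors l1 = tensors l2 ->
  tensors (reducing l1 l2) = tensors l1 /\
  links (reducing l1 l2) = links l1 :|: links l2.
Proof.
case: l1 l2 => [k1|] [k2|] //=; last by rewrite setU0.
- move=> e12; case: (decP _) => [meet12|[]].
    by split; rewrite //= {1}/chain_tensors /= -e12 setUid.
  by rewrite e12 setIid chain_tensors_neq0.
- by move/eqP; rewrite (negPf (chain_tensors_neq0 k1)).
- by move=> /esym/eqP; rewrite (negPf (chain_tensors_neq0 k2)).
Qed.

Lemma delta_class_reducing l (k1 k2 : delta_class l) :
  delta l (reducing (val k1) (val k2)).
Proof.
case: k1 k2 => [k1 /eqP d1] [k2 /eqP d2] /=.
by apply/eqP; have [-> _] := reducing_delta (etrans (esym d1) d2).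
Qed.

Definition class_reducing l (k1 k2 : delta_class l) : delta_class l :=
  Sub (reducing (val k1) (val k2)) (delta_class_reducing k1 k2).

Lemma class_links l (k1 k2 : delta_class l) :
  links (val (class_reducing k1 k2)) = links (val k1) :|: links (val k2).
Proof.
case: k1 k2 => [k1 /eqP d1] [k2 /eqP d2] /=.
by have [_ ->] := reducing_delta (etrans (esym d1) d2).
Qed.

Lemma class_inj l (k1 k2 : delta_class l) :
  links (val k1) = links (val k2) -> k1 = k2.
Proof.
case: k1 k2 => [k1 d1] [k2 d2] /= e; apply: val_inj => /=.
by apply: relations_inj => //; rewrite -(eqP d1) -(eqP d2).
Qed.

Lemma class_reducingA l : associative (@class_reducing l).
Proof. by move=> x y z; apply: class_inj; rewrite !class_links setUA. Qed.

Lemma class_reducingC l : commutative (@class_reducing l).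
Proof. by move=> x y; apply: class_inj; rewrite !class_links setUC. Qed.

Lemma class_reducingI l : idempotent_op (@class_reducing l).
Proof. by move=> x; apply: class_inj; rewrite class_links setUid. Qed.

End TensorChains.

Record semilattice := Semilattice {
  carrier :> Type;
  sl_op : carrier -> carrier -> carrier;
  sl_opA : associative sl_op;
  sl_opC : commutative sl_op;
  sl_opI : idempotent_op sl_op
}.

Definition semilattice_isomorphic (A B : semilattice) : Prop :=
  exists2 f : A -> B, bijective f & {morph f : x y / sl_op x y}.

Definition delta_semilattice (G : network) (l : relations G) : semilattice :=
  Semilattice (@class_reducingA G l) (@class_reducingC G l)
              (@class_reducingI G l).

(* Main.v *)
(** A bijection P1 -> P2 that induces a bijection between the 2-chains on P1
    and those on P2 carries connected link sets on P1 to connected link sets on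
    P2, and conversely for its inverse. Within a delta-class a chain is its
    link set and reducing is the union of link sets, which direct images
    preserve. *)
Require Import Defs.
From HB Require Import structures.
From mathcomp Require Import all_boot.

Set Implicit Arguments.
Unset Strict Implicit.
Unset Printing Implicit Defensive.

Lemma imset_in_cancel (aT rT : finType) (f : aT -> rT) (g : rT -> aT)
    (A B : {set aT}) :
  {in B, cancel f g} -> A \subset B -> g @: (f @: A) = A.
Proof.
move=> fK /subsetP sAB; rewrite -imset_comp -[RHS]imset_id.
by apply: eq_in_imset => x /sAB /fK.
Qed.

Lemma connect_homo (aT rT : finType) (e : rel aT) (e' : rel rT) (f : aT -> rT) :
  {homo f : x y / e x y >-> e' x y} ->
  {homo f : x y / connect e x y >-> connect e' x y}.
Proof.
move=> fe x y /connectP[p ep ->]; apply/connectP; exists (map f p).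
  exact: homo_path ep.
by rewrite last_map.
Qed.

(** The hypothesis keeps images of links 2-chains. Connectedness survives because the image of
    [[set t; u]] is [[set f t; f u]], so [f] sends a path of links to a path of links. *)
Lemma is_chain_imset (G : network) (f : tensor G -> tensor G)
    (P : {set tensor G}) (S : {set {set tensor G}}) :
  {in two_chains_on P, forall c : {set tensor G}, f @: c \in two_chains_on (f @: P)} ->
  is_chain (P, S) -> is_chain (f @: P, [set f @: c | c : {set tensor G} in S]).
Proof.
move=> fchain /and3P[/= P0 /subsetP sS /forall_inP conn]; apply/and3P; split => /=.
- by rewrite imset_eq0.
- by apply/subsetP => _ /imsetP[c /sS /fchain ? ->].
- apply/forall_inP => _ /imsetP[t tP ->]; apply/forall_inP => _ /imsetP[u uP ->].
  have := forall_inP (conn t tP) u uP; apply: connect_homo => {tP uP}t {}u.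
  case/and3P=> tP uP tuS; rewrite /link /= !imset_f //=.
  by rewrite -!imset_set1 -imsetU imset_f.
Qed.

(** Turns a map on a subtype into a total one, so that direct images of sets of tensors and of sets
    of links can be formed; [d] gives the values outside [A]. *)
Definition extend_sub (T : Type) (A : pred T) (U : subType A) (R : Type)
  (d : T -> R) (f : U -> R) (x : T) : R := oapp f (d x) (insub x).

Lemma extend_subE (T : Type) (A : pred T) (U : subType A) (R : Type)
    (d : T -> R) (f : U -> R) (u : U) : extend_sub d f (val u) = f u.
Proof. by rewrite /extend_sub valK. Qed.

Section DeltaClassIso.
Variables (G : network).

Definition class_of_links (l : chain G) S
    (h : is_chain (chain_tensors l, S)) : delta_class (Some l) :=
  Sub (Some (Sub (chain_tensors l, S) h)) (eqxx (chain_tensors l)).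

Lemma class_links_chain (l : chain G) (k : delta_class (Some l)) :
  is_chain (chain_tensors l, links (val k)).
Proof.
(* The empty relation is excluded: its tensor set is empty, that of [l] is not. *)
case: k => [[k|] /= /eqP /= dk]; last first.
  by move: (chain_tensors_neq0 l); rewrite dk eqxx.
by rewrite dk -surjective_pairing (valP k).
Qed.

Variables (l1 l2 : chain G) (f g : tensor G -> tensor G).
Local Notation P1 := (chain_tensors l1).
Local Notation P2 := (chain_tensors l2).

Lemma is_chain_imset_onto S : f @: P1 = P2 ->
  {in two_chains_on P1, forall c : {set tensor G}, f @: c \in two_chains_on P2} ->
  is_chain (P1, S) -> is_chain (P2, [set f @: c | c : {set tensor G} in S]).
Proof. by move=> <-; apply: is_chain_imset. Qed.

(** Cancellation is lifted twice: from tensors of [P1] to links, which are subsets of [P1], and then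
    from links to sets of links. *)
Lemma class_imset_cancel (k : delta_class (Some l1)) : {in P1, cancel f g} ->
  [set g @: c | c : {set tensor G} in
    [set f @: c | c : {set tensor G} in links (val k)]] = links (val k).
Proof.
move=> fK; case/and3P: (class_links_chain k) => _ /= sS _.
apply: imset_in_cancel sS => c; rewrite inE => /andP[_ sc].
exact: imset_in_cancel sc.
Qed.

End DeltaClassIso.

Lemma delta_semilattice_iso (G : network) (l1 l2 : chain G)
    (f g : tensor G -> tensor G) :
  f @: chain_tensors l1 = chain_tensors l2 ->
  g @: chain_tensors l2 = chain_tensors l1 ->
  {in chain_tensors l1, cancel f g} -> {in chain_tensors l2, cancel g f} ->
  {in two_chains_on (chain_tensors l1),
    forall c : {set tensor G}, f @: c \in two_chains_on (chain_tensors l2)} ->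
  {in two_chains_on (chain_tensors l2),
    forall c : {set tensor G}, g @: c \in two_chains_on (chain_tensors l1)} ->
  semilattice_isomorphic (delta_semilattice (Some l1))
                         (delta_semilattice (Some l2)).
Proof.
move=> fP gP fK gK fS gS.
pose F (k : delta_class (Some l1)) : delta_class (Some l2) :=
  class_of_links (is_chain_imset_onto fP fS (class_links_chain k)).
pose F' (k : delta_class (Some l2)) : delta_class (Some l1) :=
  class_of_links (is_chain_imset_onto gP gS (class_links_chain k)).
exists F.
  exists F' => k; apply: class_inj; first exact: (class_imset_cancel k fK).
  exact: (class_imset_cancel k gK).
move=> x y; apply: class_inj; rewrite class_links.
(* The links of [F k] are by computation the images of the links of [k]; what remains is that direct
   image commutes with union. *)
rewrite [LHS](_ : _ = [set f @: c | c : {set tensor G} in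
                        links (val (class_reducing x y))]) //.
by rewrite class_links imsetU.
Qed.

Theorem proposition3p6 (G : network) (l1 l2 : chain G)
    (cardP : #|chain_tensors l1| = #|chain_tensors l2|)
    (cardS : #|two_chains_on (chain_tensors l1)| = #|two_chains_on (chain_tensors l2)|)
    (bij : exists (theta : {t | t \in chain_tensors l1} -> {t | t \in chain_tensors l2})
                  (tau : {c | c \in two_chains_on (chain_tensors l1)} ->
                         {c | c \in two_chains_on (chain_tensors l2)}),
        [/\ bijective theta, bijective tau
          & forall (t t' : {t | t \in chain_tensors l1}) (c : {c | c \in two_chains_on (chain_tensors l1)}),
              val c = [set val t; val t'] ->
              val (tau c) = [set val (theta t); val (theta t')]]) :
  semilattice_isomorphic (delta_semilattice (Some l1))
                         (delta_semilattice (Some l2)).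
Proof.
case: bij => theta [tau [[theta' thK thK'] [tau' tauK tauK'] tauE]].
pose f := extend_sub id (val \o theta); pose g := extend_sub id (val \o theta').
have fE t : f (val t) = val (theta t) by rewrite /f extend_subE.
have gE t : g (val t) = val (theta' t) by rewrite /g extend_subE.
have fEin t (tP : t \in chain_tensors l1) : f t = val (theta (exist _ t tP)).
  by rewrite -fE.
have gEin t (tP : t \in chain_tensors l2) : g t = val (theta' (exist _ t tP)).
  by rewrite -gE.
have fK : {in chain_tensors l1, cancel f g}.
  by move=> t tP; rewrite fEin gE thK.
have gK : {in chain_tensors l2, cancel g f}.
  by move=> t tP; rewrite gEin fE thK'.
have fP1 t : t \in chain_tensors l1 -> f t \in chain_tensors l2.
  by move=> tP; rewrite fEin (valP (theta _)).
have gP2 t : t \in chain_tensors l2 -> g t \in chain_tensors l1.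
  by move=> tP; rewrite gEin (valP (theta' _)).
(* Every 2-chain on the first tensor set is a pair of its tensors, so the compatibility condition
   forces [tau] to be the direct image under [f]. *)
have tau_imset c : val (tau c) = f @: val c.
  have := valP c; rewrite inE => /andP[/existsP[t /existsP[u]]].
  case/and3P=> _ _ /eqP cE; rewrite {1}cE subUset !sub1set => /andP[tP uP].
  rewrite (tauE (exist _ t tP) (exist _ u uP) c cE).
  by rewrite cE imsetU !imset_set1 !fEin.
apply: (@delta_semilattice_iso _ _ _ f g) => //.
- apply/setP=> t; apply/imsetP/idP => [[u uP ->]|tP]; first exact: fP1.
  by exists (g t); rewrite ?gP2 ?gK.
- apply/setP=> t; apply/imsetP/idP => [[u uP ->]|tP]; first exact: gP2.
  by exists (f t); rewrite ?fP1 ?fK.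
- move=> c cS; have := valP (tau (exist _ c cS)).
  by rewrite tau_imset.
(* Here surjectivity of [tau] enters: each 2-chain [c] on the second tensor set is the image of a
   2-chain [c'] on the first, and [g] maps [c] back to [c']. Thus [g] preserves 2-chains as well. *)
- move=> c cS; pose c' := tau' (exist _ c cS).
  have cE : c = f @: val c' by rewrite -tau_imset tauK'.
  have := valP c'; rewrite cE inE => /andP[c'2 sc'].
  by rewrite (imset_in_cancel fK) // inE c'2.
Qed.
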